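(* Assume $\lambda^*/n\to0$ and $\lambda^*\to\infty$, and assume the limits $\lambda^0_j=\lim\lambda_j/\lambda^*\in[0,1]$ and $\psi_j=\lim\sqrt{\lambda^*}/\lambda_j\in[0,\infty]$ exist for all $j$. Let $(\beta_n)$ be a sequence in $\mathbb{R}^p$ such that for every $j$ with $\lambda_j>0$ for all large $n$, $\sqrt{n}\,\beta_{n,j}\sqrt{\lambda^*}/\lambda_j\to\phi_j\in\overline{\mathbb{R}}$, while for $j$ with $\lambda_j=0$ for all large $n$ (so $\psi_j=\infty$) $\phi_j\in\overline{\mathbb{R}}$ is arbitrary. Then, under $P_{\beta_n}$, $$\sqrt{\tfrac{n}{\lambda^*}}(\hat\beta_{AL}-\beta_n)\overset{d}{\longrightarrow}\arg\min_{u\in\mathbb{R}^p}V_\phi(u),$$ where $V_\phi(u)=u'Cu+\sum_{j=1}^pA_{\phi,j}(u_j)$ with $$A_{\phi,j}(u_j)=\begin{cases}0 & u_j=0\text{ or }|\phi_j|=\infty\text{ or }\psi_j=\infty,\\ \infty & u_j\ne0\text{ and }\phi_j=\psi_j=0,\\ 2\,\dfrac{|u_j+\lambda^0_j\phi_j|-|\lambda^0_j\phi_j|}{|\phi_j+\psi_jZ_j|} & \text{otherwise},\end{cases}$$ and $Z\sim N(0,\sigma^2C^{-1})$.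
   Context: For each $n\ge p$: linear regression model $y=X\beta+\varepsilon$ with $y\in\mathbb{R}^n$, non-stochastic $X\in\mathbb{R}^{n\times p}$ ($p$ fixed) of full column rank, unknown parameter, and $\varepsilon$ with i.i.d. components of mean zero and finite variance $\sigma^2>0$; $P_\beta$ is the probability when the true parameter is $\beta$. $X'X/n\to C$ positive definite, and $\sqrt{n}(X'X)^{-1}X'\varepsilon\overset{d}{\longrightarrow}N(0,\sigma^2C^{-1})$. $\hat\beta_{LS}=(X'X)^{-1}X'y$; the events $\{\hat\beta_{LS,j}=0\}$ have probability zero and are excluded. Non-negative tuning parameters $\lambda_j=\lambda_{n,j}$ (each either positive for all large $n$ or zero for all large $n$), $\lambda^*=\max_j\lambda_j$, with the convention $\sqrt{\lambda^*}/0=\infty$. Adaptive Lasso: $\hat\beta_{AL}=\arg\min_{b\in\mathbb{R}^p}\big(\|y-Xb\|^2+2\sum_{j=1}^p\lambda_j|b_j|/|\hat\beta_{LS,j}|\big)$. $\overline{\mathbb{R}}=\mathbb{R}\cup\{\pm\infty\}$. $V_\phi$ is strictly convex (possibly taking value $+\infty$), so its minimizer is unique. *)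

(* Defs.v *)
From HB Require Import structures.
From mathcomp Require Import all_boot all_order all_algebra.
From mathcomp Require Import all_classical all_reals all_analysis.
Set Implicit Arguments. Unset Strict Implicit. Unset Printing Implicit Defensive.
Import Order.TTheory GRing.Theory Num.Theory.
Import numFieldNormedType.Exports.
Local Open Scope classical_set_scope.
Local Open Scope ring_scope.

Section defs.
Context {R : realType}.

Definition qform p (C : 'M[R]_p) (u : 'cV[R]_p) : R := (u^T *m C *m u) ord0 ord0.

Definition posdef p (C : 'M[R]_p) : Prop :=
  C^T = C /\ forall u : 'cV[R]_p, u != 0 -> 0 < qform C u.

Definition rand_mx d (Omega : measurableType d) m n (X : Omega -> 'M[R]_(m, n)) : Prop :=
  forall i j, measurable_fun setT (fun w => X w i j).

Definition cvg_in_dist d d' (Omega : measurableType d) (Omega' : measurableType d') p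
    (P : probability Omega R) (Xn : nat -> Omega -> 'cV[R]_p)
    (Q : probability Omega' R) (Y : Omega' -> 'cV[R]_p) : Prop :=
  forall f : 'cV[R]_p -> R, continuous f -> (exists M : R, forall x, `|f x| <= M) ->
    ((fun n => \int[P]_w (f (Xn n w))%:E) @ \oo --> \int[Q]_w (f (Y w))%:E)%E.

(** Z ~ N(0, Sigma) (Cramer-Wold definition: every linear form a'Z is
    univariate normal N(0, a' Sigma a), degenerate = Dirac at 0) *)
Definition gaussian_vec d (Omega : measurableType d) p (Q : probability Omega R)
    (Z : Omega -> 'cV[R]_p) (Sigma : 'M[R]_p) : Prop :=
  rand_mx Z /\
  forall (a : 'cV[R]_p) (B : set R), measurable B ->
    Q ((fun w => (a^T *m Z w) ord0 ord0) @^-1` B) =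
    (if qform Sigma a == 0 then dirac (0 : R) B
     else normal_prob 0 (Num.sqrt (qform Sigma a)) B).

Definition iid_errors d (Omega : measurableType d) (P : probability Omega R) n
    (e : Omega -> 'cV[R]_n) (sigma : R) : Prop :=
  [/\ rand_mx e,
   (forall B : 'I_n -> set R, (forall i, measurable (B i)) ->
      P (\bigcap_(i in [set: 'I_n]) ((fun w => e w i ord0) @^-1` B i)) =
      (\prod_(i < n) P ((fun w => e w i ord0) @^-1` B i))%E),
   (forall (i j : 'I_n) (B : set R), measurable B ->
      P ((fun w => e w i ord0) @^-1` B) = P ((fun w => e w j ord0) @^-1` B)) &
   (forall i, P.-integrable setT (fun w => (e w i ord0)%:E) /\
      (\int[P]_w (e w i ord0)%:E = 0)%E /\
      (\int[P]_w ((e w i ord0) ^+ 2)%:E = (sigma ^+ 2)%:E)%E)].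

Definition ls_est n p (X : 'M[R]_(n, p)) (y : 'cV[R]_n) : 'cV[R]_p :=
  invmx (X^T *m X) *m (X^T *m y).

Definition al_obj n p (X : 'M[R]_(n, p)) (y : 'cV[R]_n) (lam : 'I_p -> R)
    (b : 'cV[R]_p) : R :=
  (\sum_(i < n) ((y - X *m b) i ord0) ^+ 2) +
  2 * \sum_(j < p) lam j * `|b j ord0| / `|ls_est X y j ord0|.

Definition is_argmin (T : Type) (f : T -> R) (x : T) : Prop := forall z, f x <= f z.
Definition is_argmin_e (T : Type) (f : T -> \bar R) (x : T) : Prop :=
  forall z, (f x <= f z)%E.

(** lambda_star = max_j lambda_j (the lambda_j are nonnegative) *)
Definition lam_star p (lam : 'I_p -> R) : R := \big[Num.max / 0]_(j < p) lam j.

Definition psi_seq (ls l : R) : \bar R :=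
  if l == 0 then +oo%E else (Num.sqrt ls / l)%:E.

Definition A_phi (lam0 : R) (phi psi : \bar R) (z u : R) : \bar R :=
  if (u == 0) || (phi == +oo%E) || (phi == -oo%E) || (psi == +oo%E) then 0%E
  else if (phi == 0%E) && (psi == 0%E) then +oo%E
  else (2 * (`|u + lam0 * fine phi| - `|lam0 * fine phi|)
          / `|fine phi + fine psi * z|)%:E.

(** V_phi(u) = u'Cu + sum_j A_{phi,j}(u_j), where z is the realisation of Z *)
Definition V_phi p (C : 'M[R]_p) (lam0 : 'I_p -> R) (phi psi : 'I_p -> \bar R)
    (z u : 'cV[R]_p) : \bar R :=
  ((qform C u)%:E + \sum_(j < p) A_phi (lam0 j) (phi j) (psi j) (z j ord0) (u j ord0))%E.

End defs.

(* Main.v *)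
(** With s = sqrt (lam_star / n), y = sqrt n * (beta_LS - beta_n) and
    tau_j = sqrt n * beta_{n,j}, the increment of the objective from beta_n to
    beta_n + s u is lam_star times

      u' C_n u - 2 u' C_n y / sqrt lam_star + sum_j w_j (|u_j + a_j| - |a_j|),

    with w_j = 2 lam_j / (sqrt lam_star |tau_j + y_j|) and a_j = tau_j / sqrt lam_star.
    Hence the rescaled estimator is related to y, which converges in law to Z, by a
    deterministic relation: minimising this strictly convex function.  As y tends to a
    typical z, the C_n, w_j, a_j converge to the data of V_phi (w_j tending to infinity
    when phi_j = psi_j = 0), and a compactness argument makes the minimisers converge.
    The conclusion follows from an extended continuous mapping theorem for relations.
    When psi_j is infinite, w_j vanishes in the limit only if tau_j + y_j stays away
    from 0; as beta_n is arbitrary there, one first restricts to index sets, chosen by an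
    ultrafilter, along which tau_j converges in the extended reals to some t_j, and then
    Z_j = - t_j has probability zero. *)

Require Import Defs.
From HB Require Import structures.
From mathcomp Require Import all_boot all_order all_algebra.
From mathcomp Require Import all_classical all_reals all_analysis.
From mathcomp Require Import measurable_realfun ring lra.
Set Implicit Arguments. Unset Strict Implicit. Unset Printing Implicit Defensive.
Import Order.TTheory GRing.Theory Num.Theory.
Import numFieldNormedType.Exports.
Local Open Scope classical_set_scope.
Local Open Scope ring_scope.

(** * Quadratic forms with weighted absolute-value penalties, and stability of their minimisers *)

Section penalised_quadratic.
Context {R : realType}.

Lemma qformE p (C : 'M[R]_p) (u : 'cV[R]_p) :
  qform C u = \sum_i \sum_j u j ord0 * C j i * u i ord0.
Proof.
rewrite /qform mxE; apply: eq_bigr => i _; rewrite mxE mulr_suml.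
by apply: eq_bigr => j _; rewrite mxE.
Qed.

Lemma qform_segment p (C : 'M[R]_p) (v h : 'cV[R]_p) (t : R) :
  qform C (v + t *: h) =
  (1 - t) * qform C v + t * qform C (v + h) - t * (1 - t) * qform C h.
Proof.
rewrite !qformE !mulr_sumr -big_split /= -sumrB; apply: eq_bigr => i _.
rewrite !mulr_sumr -big_split /= -sumrB; apply: eq_bigr => j _.
by rewrite !mxE; ring.
Qed.

(** Subtracting [|a j|] normalises the value at 0 to 0 and bounds the size of each penalty term by
    [w j * |u j|], however large [a j] is. *)
Definition pen_quad p (C : 'M[R]_p) (b : 'cV[R]_p) (w a : 'I_p -> R)
    (u : 'cV[R]_p) : R :=
  qform C u - 2 * \sum_j b j ord0 * u j ord0 +
  \sum_j w j * (`|u j ord0 + a j| - `|a j|).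

(** Strong convexity: the defect [t * (1 - t) * qform C h] comes from the quadratic part by an exact
    identity, the linear part is affine, and the penalty is convex by the triangle inequality. *)
Lemma pen_quad_segment p (C : 'M[R]_p) (b : 'cV[R]_p) (w a : 'I_p -> R)
    (v h : 'cV[R]_p) (t : R) :
  (forall j, 0 <= w j) -> 0 <= t <= 1 ->
  pen_quad C b w a (v + t *: h) <=
  (1 - t) * pen_quad C b w a v + t * pen_quad C b w a (v + h)
  - t * (1 - t) * qform C h.
Proof.
move=> w0 /andP[t0 t1]; rewrite /pen_quad qform_segment.
have -> : \sum_j b j ord0 * (v + t *: h) j ord0 =
    (1 - t) * (\sum_j b j ord0 * v j ord0) +
    t * \sum_j b j ord0 * (v + h) j ord0.
  rewrite !mulr_sumr -big_split /=; apply: eq_bigr => j _.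
  by rewrite !mxE; ring.
have : \sum_j w j * (`|(v + t *: h) j ord0 + a j| - `|a j|) <=
    (1 - t) * (\sum_j w j * (`|v j ord0 + a j| - `|a j|)) +
    t * \sum_j w j * (`|(v + h) j ord0 + a j| - `|a j|).
  rewrite !mulr_sumr -big_split /=; apply: ler_sum => j _.
  rewrite !mxE; set x := v j ord0; set y := h j ord0.
  have le : `|x + t * y + a j| <= (1 - t) * `|x + a j| + t * `|x + y + a j|.
    have -> : x + t * y + a j = (1 - t) * (x + a j) + t * (x + y + a j) by ring.
    by rewrite (le_trans (ler_normD _ _))// !normrM (ger0_norm t0) ger0_norm ?subr_ge0.
  have := ler_wpM2l (w0 j) le; lra.
lra.
Qed.

(** Compactness of [[- B, B]] gives a cluster point, and an ultrafilter converges to each of its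
    cluster points. *)
Lemma ultra_bounded_cvg {T : Type} (G : set_system T) (f : T -> R) (B : R) :
  UltraFilter G -> (\forall t \near G, `|f t| <= B) -> exists x : R, f @ G --> x.
Proof.
move=> GU fB.
have fG : (f @ G) `[- B, B]%classic.
  by apply: filterS fB => t; rewrite /= in_itv/= ler_norml.
have [x [_ clx]] := @segment_compact R (- B) B (f @ G) _ fG.
exists x => A xA; have [//|GA] := in_ultra_setVsetC (f @^-1` A) GU.
by have [y []] := clx (~` A) A GA xA.
Qed.

Lemma cvg_sumr {T I : Type} (F : set_system T) {FF : Filter F} (s : seq I)
    (P : pred I) (f : I -> T -> R) (l : I -> R) :
  (forall i, P i -> f i t @[t --> F] --> l i) ->
  \sum_(i <- s | P i) f i t @[t --> F] --> \sum_(i <- s | P i) l i.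
Proof.
by move=> fl; apply: cvg_big => //; exact: add_continuous.
Qed.

(* The indices in [S] are those whose penalty becomes infinite.  There the competitor of
   a minimiser is [- at_ t j], where the penalty is smallest, rather than [u0 j]: the
   minimal value [- wt t j * `|at_ t j|] need not tend to 0.  Convexity allows one to
   move a far minimiser to l1-distance [e / 2] of the competitor, so that coordinates
   converge along an ultrafilter, to a point contradicting strict convexity. *)
Lemma pen_quad_argmin_near {T : Type} (F : set_system T) {FF : Filter F} p
    (C : 'M[R]_p) (Ct : T -> 'M[R]_p) (bt : T -> 'cV[R]_p)
    (wt at_ : T -> 'I_p -> R) (w a : 'I_p -> R) (S : pred 'I_p) (u0 : 'cV[R]_p) :
  (forall u : 'cV[R]_p, u != 0 -> 0 < qform C u) ->
  (forall t u, 0 <= qform (Ct t) u) ->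
  (forall i j, Ct t i j @[t --> F] --> C i j) ->
  (forall j, bt t j ord0 @[t --> F] --> 0) ->
  (forall t j, 0 <= wt t j) ->
  (forall j, ~~ S j -> wt t j @[t --> F] --> w j) ->
  (forall j, ~~ S j -> w j = 0 \/ at_ t j @[t --> F] --> a j) ->
  (forall j, S j -> \forall t \near F, 0 < wt t j) ->
  (forall j, S j -> (wt t j)^-1 @[t --> F] --> 0) ->
  (forall j, S j -> at_ t j @[t --> F] --> 0) ->
  (forall j, S j -> w j = 0) -> (forall j, 0 <= w j) ->
  (forall j, S j -> u0 j ord0 = 0) ->
  (forall v : 'cV[R]_p, (forall j, S j -> v j ord0 = 0) ->
     pen_quad C 0 w a u0 <= pen_quad C 0 w a v) ->
  forall e, 0 < e -> \forall t \near F, forall u,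
    is_argmin (pen_quad (Ct t) (bt t) (wt t) (at_ t)) u ->
    forall j, `|u j ord0 - u0 j ord0| < e.
Proof.
move=> Cpos Ct0 CtC bt0 wt0 wtw ata Swt Swt0 Sat Sw w0 Su0 u0min e e0.
pose good : set T := [set t | forall u,
  is_argmin (pen_quad (Ct t) (bt t) (wt t) (at_ t)) u ->
  forall j, `|u j ord0 - u0 j ord0| < e].
change (F good); apply: contrapT => nF.
(* If [good] is not in [F], the trace of [F] on its complement is proper, hence contained in an
   ultrafilter [G] along which bad minimisers exist. *)
have WF : ProperFilter (within (~` good) F).
  split; last exact: within_filter.
  by rewrite /within /= => h; apply: nF; apply: filterS h => t /=; exact: contrapT.
have [G [GU sG]] := ultraFilterLemma WF.
have GP : ProperFilter G by exact: ultra_proper.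
have GF A : F A -> G A by move=> FA; apply: sG; apply: filterS FA => t.
have GFc (f : T -> R) (l : R) : f @ F --> l -> f @ G --> l.
  by move=> fl A /fl; exact: GF.
have Ggood : G (~` good).
  by apply: sG; apply: (@filterS _ F) filterT => t.
have exu t : exists u : 'cV[R]_p, (~` good) t ->
    is_argmin (pen_quad (Ct t) (bt t) (wt t) (at_ t)) u /\
    exists j, e <= `|u j ord0 - u0 j ord0|.
  have [gt|] := pselect (good t); first by exists 0 => /(_ gt).
  move=> /existsNP[u /not_implyP[um /existsNP[j /negP]]].
  by rewrite -leNgt => uj; exists u => _; split => //; exists j.
have [u uP] := choice exu.
pose v t : 'cV[R]_p := \col_j (if S j then - at_ t j else u0 j ord0).
have vE t j : v t j ord0 = if S j then - at_ t j else u0 j ord0 by rewrite mxE.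
have vu0 j : v t j ord0 @[t --> G] --> u0 j ord0.
  rewrite (_ : (fun t => v t j ord0) = fun t => if S j then - at_ t j else u0 j ord0);
    last by apply/funext => t.
  case: (boolP (S j)) => [Sj|_] /=; last exact: cvg_cst.
  by rewrite Su0// -oppr0; apply: cvgN; apply: GFc; exact: Sat.
pose r t := \sum_j `|u t j ord0 - v t j ord0|.
pose de := e / 2.
have de0 : 0 < de by rewrite divr_gt0.
(* Some coordinate of [u t] is at least [e] away from [u0], while [v t] tends to [u0]; this leaves
   at least [e / 2] between [u t] and [v t]. *)
have rde : \forall t \near G, de <= r t.
  have vn : \forall t \near G, forall j, `|u0 j ord0 - v t j ord0| < de.
    apply: filter_forall => j.
    by have /cvgrPdist_lt /(_ _ de0) := vu0 j.
  near=> t.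
  have /uP[_ [j uj]] : (~` good) t by near: t.
  have vj : forall j, `|u0 j ord0 - v t j ord0| < de by near: t.
  move: vj => /(_ j) vj.
  rewrite /r (bigD1 j)//= (@le_trans _ _ `|u t j ord0 - v t j ord0|)//.
    have := ler_distD (v t j ord0) (u t j ord0) (u0 j ord0).
    by rewrite (distrC (v t j ord0)) /de in vj *; lra.
  by rewrite lerDl sumr_ge0.
pose h t := (de / r t) *: (u t - v t).
have hE t j : h t j ord0 = (de / r t) * (u t j ord0 - v t j ord0) by rewrite !mxE.
have hnorm : \forall t \near G, \sum_j `|h t j ord0| = de.
  near=> t.
  have rt : de <= r t by near: t.
  have rt0 : 0 < r t by rewrite (lt_le_trans de0).
  under eq_bigr do rewrite hE normrM.
  by rewrite -mulr_sumr -/(r t) ger0_norm ?divr_ge0 ?ltW// divfK ?gt_eqF.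
have hle : \forall t \near G,
    pen_quad (Ct t) (bt t) (wt t) (at_ t) (v t + h t) <=
    pen_quad (Ct t) (bt t) (wt t) (at_ t) (v t).
  near=> t.
  have /uP[um _] : (~` good) t by near: t.
  have rt : de <= r t by near: t.
  have rt0 : 0 < r t by rewrite (lt_le_trans de0).
  have t01 : 0 <= de / r t <= 1.
    by apply/andP; split; [rewrite divr_ge0// ltW|rewrite ler_pdivrMr// mul1r].
  have := pen_quad_segment (Ct t) (bt t) (at_ t) (v t) (u t - v t) (wt0 t) t01.
  rewrite -/(h t) subrKC; have := um (v t).
  have := Ct0 t (u t - v t).
  move/andP : t01 => []; move: (de / r t) => s s0 s1 q0 um' /le_trans; apply.
  have : 0 <= s * (1 - s) * qform (Ct t) (u t - v t).
    by rewrite !mulr_ge0// subr_ge0.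
  have := ler_wpM2l s0 um'; lra.
have hcvg j : exists x : R, h t j ord0 @[t --> G] --> x.
  apply: (@ultra_bounded_cvg _ G _ de) => //; apply: filterS hnorm => t <-.
  by rewrite (bigD1 j)//= lerDl sumr_ge0.
have [hs_ hsP_] := choice hcvg.
pose hs : 'cV[R]_p := \col_j hs_ j.
have hsP j : h t j ord0 @[t --> G] --> hs j ord0 by rewrite mxE.
have hs0 : hs != 0.
  have [hs0|//] := eqVneq hs 0; exfalso.
  have c1 : (fun t => \sum_j `|h t j ord0|) @ G --> \sum_j `|hs j ord0|.
    by apply: cvg_sumr => j _; exact: cvg_norm.
  have c2 : (fun t => \sum_j `|h t j ord0|) @ G --> de.
    by apply: cvg_near_cst; apply: filterS hnorm => t ->.
  have := cvg_unique (@Rhausdorff R) c1 c2.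
  rewrite big1 => [de00|j _]; last by rewrite hs0 mxE normr0.
  by move: de0; rewrite -de00 ltxx.
(* [M t] gathers the terms of the increment from [v t] to [v t + h t] that have a limit. For [j] in
   [S] the competitor satisfies [v j + at_ j = 0], so what remains is exactly [wt j * |h j|], which
   is nonnegative. *)
pose M t := qform (Ct t) (v t + h t) - qform (Ct t) (v t)
  - 2 * (\sum_j bt t j ord0 * h t j ord0)
  + \sum_(j | ~~ S j) wt t j *
      (`|u0 j ord0 + h t j ord0 + at_ t j| - `|u0 j ord0 + at_ t j|).
have ME t : pen_quad (Ct t) (bt t) (wt t) (at_ t) (v t + h t) -
    pen_quad (Ct t) (bt t) (wt t) (at_ t) (v t) =
    M t + \sum_(j | S j) wt t j * `|h t j ord0|.
  rewrite /pen_quad /M.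
  have -> : \sum_j bt t j ord0 * (v t + h t) j ord0 =
      \sum_j bt t j ord0 * v t j ord0 + \sum_j bt t j ord0 * h t j ord0.
    by rewrite -big_split /=; apply: eq_bigr => j _; rewrite [X in _ * X]mxE mulrDr.
  have : \sum_j wt t j * (`|(v t + h t) j ord0 + at_ t j| - `|at_ t j|) -
      \sum_j wt t j * (`|v t j ord0 + at_ t j| - `|at_ t j|) =
      \sum_(j | ~~ S j) wt t j *
      (`|u0 j ord0 + h t j ord0 + at_ t j| - `|u0 j ord0 + at_ t j|) +
      \sum_(j | S j) wt t j * `|h t j ord0|.
    rewrite -sumrB (bigID S) /= addrC; congr (_ + _); apply: eq_bigr => j.
      by move=> /negbTE Sj; rewrite [(v t + h t) _ _]mxE vE Sj; ring.
    move=> Sj; rewrite [(v t + h t) _ _]mxE vE Sj.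
    have -> : - at_ t j + h t j ord0 + at_ t j = h t j ord0 by ring.
    by rewrite addNr normr0; ring.
  lra.
have hM : \forall t \near G, M t + \sum_(j | S j) wt t j * `|h t j ord0| <= 0.
  by apply: filterS hle => t; rewrite -ME subr_le0.
have qcvg (f : T -> 'cV[R]_p) (l : 'cV[R]_p) : (forall j, f t j ord0 @[t --> G] --> l j ord0) ->
    qform (Ct t) (f t) @[t --> G] --> qform C l.
  move=> fl; rewrite (funext (fun t => qformE (Ct t) (f t))) qformE; apply: cvg_sumr => i _; apply: cvg_sumr => j _.
  apply: cvgM; last exact: fl.
  by apply: cvgM; [exact: fl|exact: GFc].
have MM : M @ G --> pen_quad C 0 w a (u0 + hs) - pen_quad C 0 w a u0.
  have -> : pen_quad C 0 w a (u0 + hs) - pen_quad C 0 w a u0 =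
      qform C (u0 + hs) - qform C u0 - 2 * (\sum_(j < p) 0 * hs j ord0)
      + \sum_(j | ~~ S j) w j *
        (`|u0 j ord0 + hs j ord0 + a j| - `|u0 j ord0 + a j|).
    rewrite /pen_quad.
    have s0 (x : 'cV[R]_p) : \sum_j (0 : 'cV[R]_p) j ord0 * x j ord0 = 0.
      by rewrite big1// => j _; rewrite mxE mul0r.
    rewrite !s0 -mulr_sumr mul0r.
    have : \sum_j w j * (`|(u0 + hs) j ord0 + a j| - `|a j|) -
      \sum_j w j * (`|u0 j ord0 + a j| - `|a j|) =
      \sum_(j | ~~ S j) w j *
      (`|u0 j ord0 + hs j ord0 + a j| - `|u0 j ord0 + a j|).
      rewrite -sumrB (bigID S) /= big1 ?add0r => [|j Sj]; last by rewrite Sw//; ring.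
      by apply: eq_bigr => j _; rewrite [(u0 + hs) _ _]mxE; ring.
    lra.
  apply: cvgD.
    apply: cvgB.
      apply: cvgB; apply: qcvg => // j.
      rewrite mxE (_ : (fun t => (v t + h t) j ord0) = fun t => v t j ord0 + h t j ord0).
        exact: cvgD.
      by apply/funext => t; rewrite mxE.
    apply: cvgM; first exact: cvg_cst.
    by apply: cvg_sumr => j _; apply: cvgM => //; exact: GFc.
  apply: cvg_sumr => j Sj.
  have [wj|aj] := ata j Sj; last first.
    have aj' := GFc _ _ aj.
    apply: cvgM; first by apply: GFc; exact: wtw.
    by apply: cvgB; apply: cvg_norm; apply: cvgD => //; [apply: cvgD => //|]; exact: cvg_cst.
  (* Here [at_] may fail to converge; the difference of absolute values is still at most [|h t j|],
     and the weight tends to 0. *)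
  have wt_0 : wt t j @[t --> G] --> 0 by rewrite -wj; apply: GFc; exact: wtw.
  rewrite wj mul0r; apply/norm_cvg0P.
  apply: (@squeeze_cvgr _ _ _ _ (fun=> 0) (fun t => wt t j * `|h t j ord0|)).
  - near=> t; rewrite normr_ge0 normrM (ger0_norm (wt0 t j))/= ler_wpM2l//.
    have := ler_dist_dist (u0 j ord0 + h t j ord0 + at_ t j) (u0 j ord0 + at_ t j).
    by congr (_ <= `| _ |); ring.
  - exact: cvg_cst.
  - by rewrite -(mul0r `|hs j ord0|); apply: cvgM => //; exact: cvg_norm.
have S0 (t : T) : 0 <= \sum_(j | S j) wt t j * `|h t j ord0|.
  by apply: sumr_ge0 => j _; rewrite mulr_ge0.
have Mle : pen_quad C 0 w a (u0 + hs) <= pen_quad C 0 w a u0.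
  rewrite -subr_le0; apply: (cvgr_to_le MM).
  by near=> t; have : M t + \sum_(j | S j) wt t j * `|h t j ord0| <= 0 by [near: t]; have := S0 t; lra.
(* Dividing [M t + wt t j * |h t j| <= 0] by the diverging weight, with [M] convergent, forces
   [h t j] to tend to 0. *)
have hsS j : S j -> hs j ord0 = 0.
  move=> Sj; apply/eqP; rewrite -normr_le0.
  have c1 : (- M t * (wt t j)^-1) @[t --> G] --> 0.
    rewrite -[X in _ --> X](mulr0 (- (pen_quad C 0 w a (u0 + hs) - pen_quad C 0 w a u0))).
    by apply: cvgM; [exact: cvgN|apply: GFc; exact: Swt0].
  have c2 : `|h t j ord0| @[t --> G] --> `|hs j ord0| by exact: cvg_norm.
  rewrite -[leLHS]subr0; apply: (cvgr_to_le (cvgB c2 c1)); near=> t.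
  have wj0 : 0 < wt t j by near: t; apply: GF; exact: Swt.
  rewrite /= subr_le0 ler_pdivlMr// mulrC.
  have : M t + \sum_(j | S j) wt t j * `|h t j ord0| <= 0 by near: t.
  rewrite (bigD1 j)//=.
  have : 0 <= \sum_(i | S i && (i != j)) wt t i * `|h t i ord0|.
    by apply: sumr_ge0 => i _; rewrite mulr_ge0.
  lra.
(* [u0 + hs] satisfies the constraints and does at least as well as [u0], so by strong convexity the
   midpoint does strictly better, against minimality of [u0]. *)
have half : 0 <= (1 / 2 : R) <= 1 by lra.
have mid0 j : S j -> (u0 + (1 / 2) *: hs) j ord0 = 0.
  by move=> Sj; rewrite mxE Su0// mxE hsS// mulr0 addr0.
have := pen_quad_segment C 0 a u0 hs w0 half.
have := u0min _ mid0; have := Cpos _ hs0; lra.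
Unshelve. all: by end_near. Qed.

End penalised_quadratic.

(** * Measurability of continuous functions of random vectors *)

Section random_vectors.
Context {R : realType} {d : measure_display} {Omega : measurableType d}.

(** The preimage is a countable union of fibres of [F], which lets [phi] and [B] be arbitrary. *)
Lemma countable_comp_measurable (I : countType) (V : Type) (F : Omega -> I)
    (phi : I -> V) (B : set V) :
  (forall i, measurable (F @^-1` [set i])) ->
  measurable ((phi \o F) @^-1` B).
Proof.
move=> mF.
have -> : (phi \o F) @^-1` B =
    \bigcup_i (if `[< B (phi i) >] then F @^-1` [set i] else set0).
  apply/seteqP; split=> [w Bw|w [i _]].
    by exists (F w) => //; rewrite asboolT.
  by case: asboolP => // Bi /= ->.
apply: countable_bigcupT_measurable; first exact: countableP.
by move=> i; case: asboolP.
Qed.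

(* Rounding the coordinates to the grid (n+1)^-1 Z turns [f \o X] into a limit of
   functions of a countably valued random vector. *)
Lemma rand_mx_continuous p (X : Omega -> 'cV[R]_p) (f : 'cV[R]_p -> R) :
  rand_mx X -> continuous f -> measurable_fun setT (f \o X).
Proof.
move=> mX cf.
pose F (n : nat) (w : Omega) : 'cV[int]_p :=
  \col_i Num.floor (n.+1%:R * X w i ord0).
pose G (n : nat) (v : 'cV[int]_p) : 'cV[R]_p := \col_i ((v i ord0)%:~R / n.+1%:R).
apply: (@measurable_fun_cvg _ _ _ _ (fun n => f \o (G n) \o (F n))).
  move=> n _ B mB; rewrite setTI.
  apply: (@countable_comp_measurable 'cV[int]_p) => v.
  have -> : F n @^-1` [set v] = \bigcap_(i in [set: 'I_p])
      ((fun w => n.+1%:R * X w i ord0) @^-1` `[(v i ord0)%:~R, (v i ord0 + 1)%:~R[%classic).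
    apply/seteqP; split=> [w /= <- i _|w /= h].
      by rewrite /F mxE /= in_itv/=; exact: floor_itv.
    apply/colP => i; rewrite mxE; apply/floor_def.
    by have := h i I; rewrite /= in_itv.
  apply: fin_bigcap_measurable => // i _.
  rewrite -[X in measurable X]setTI.
  have : measurable_fun setT (fun w => n.+1%:R * X w i ord0).
    by apply: measurable_funM => //; exact: mX.
  by apply => //.
move=> w _; apply: (@cvg_comp _ _ _ (fun n => G n (F n w)) f _ (nbhs (X w))); last exact: cf.
apply/cvgrPdist_lt => e e0; near=> n.
rewrite [ltLHS]mx_normrE; apply: bigmax_lt => // -[i j] _ /=.
rewrite !mxE (ord1 j).
have n0 : 0 < n.+1%:R :> R by [].
have /andP[l1 l2] := floor_itv (n.+1%:R * X w i ord0).
have {}l2 : n.+1%:R * X w i ord0 < (Num.floor (n.+1%:R * X w i ord0))%:~R + 1.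
  by rewrite -intrD1.
have -> : X w i ord0 - (Num.floor (n.+1%:R * X w i ord0))%:~R / n.+1%:R =
   (n.+1%:R * X w i ord0 - (Num.floor (n.+1%:R * X w i ord0))%:~R) / n.+1%:R.
  by field.
rewrite ger0_norm ?divr_ge0 ?subr_ge0 ?(ltW n0)//.
rewrite ltr_pdivrMr//.
have : e^-1 < n%:R by near: n; exact: nbhs_infty_gtr.
move=> /lt_trans /(_ (_ : _ < n.+1%:R)); rewrite ltr_nat => /(_ (leqnn _)).
rewrite -(ltr_pM2l e0) divff ?gt_eqF//; lra.
Unshelve. all: by end_near. Qed.

End random_vectors.

(** * Expectations of bounded random variables *)

Section bounded_expectation.
Context {R : realType} {d : measure_display} {Omega : measurableType d}.
Variable P : probability Omega R.
Implicit Types f g : Omega -> R.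

Lemma bounded_integrable f (M : R) :
  measurable_fun setT f -> (forall w, `|f w| <= M) ->
  P.-integrable setT (EFin \o f).
Proof.
move=> mf fM; apply: measurable_bounded_integrable => //.
  by apply: (le_lt_trans (probability_le1 P measurableT)); rewrite ltry.
exists M; split; first exact: num_real.
by move=> x Mx w _; apply: (le_trans (fM w)); exact: ltW.
Qed.

(** Replacing [g] by the maximum of [f] and [g] leaves its integral unchanged and makes the
    inequality hold everywhere. *)
Lemma ae_le_expectation f g (M : R) :
  measurable_fun setT f -> measurable_fun setT g ->
  (forall w, `|f w| <= M) -> (forall w, `|g w| <= M) ->
  {ae P, forall w, f w <= g w} ->
  (\int[P]_w (f w)%:E <= \int[P]_w (g w)%:E)%E.
Proof.
move=> mf mg fM gM fg.
have mm : measurable_fun setT (f \max g) by exact: measurable_maxr.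
have maxM w : `|Num.max (f w) (g w)| <= M by rewrite /Num.max; case: ifP.
have <- : (\int[P]_w (Num.max (f w) (g w))%:E = \int[P]_w (g w)%:E)%E.
  apply: ae_eq_integral => //; try exact/measurable_EFinP.
  by apply: filterS fg => w fgw _; rewrite (max_idPr fgw).
apply: le_integral => //.
- exact: bounded_integrable mf fM.
- exact: bounded_integrable mm maxM.
- by move=> w _; rewrite lee_fin le_max lexx.
Qed.

Lemma bounded_expectation_fin_num f (M : R) :
  measurable_fun setT f -> (forall w, `|f w| <= M) ->
  (\int[P]_w (f w)%:E)%E \is a fin_num.
Proof.
by move=> mf fM; apply: integrable_fin_num => //; exact: bounded_integrable mf fM.
Qed.

Lemma bounded_expectation_cvg (f_ : nat -> Omega -> R) f (M : R) :
  (forall n, measurable_fun setT (f_ n)) -> measurable_fun setT f ->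
  (forall n w, `|f_ n w| <= M) ->
  {ae P, forall w, f_ ^~ w @ \oo --> f w} ->
  (fun n => \int[P]_w (f_ n w)%:E)%E @ \oo --> (\int[P]_w (f w)%:E)%E.
Proof.
move=> mf_ mf fM fcvg.
have [] := @dominated_convergence _ _ _ P setT measurableT
  (fun n => EFin \o f_ n) (EFin \o f) (cst M%:E) => //.
- by move=> n; exact/measurable_EFinP.
- exact/measurable_EFinP.
- by apply: filterS fcvg => w fw _; apply: cvg_EFin => //; exact: nearW.
- exact: finite_measure_integrable_cst.
- by apply/nearW => w n _; rewrite /= lee_fin.
Qed.

End bounded_expectation.

(** * An extended continuous mapping theorem for relations *)

Section relational_mapping.
Context {R : realType} {d d' : measure_display}.
Context {Omega : measurableType d} {Omega' : measurableType d'} {p : nat}.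
Variables (P : probability Omega R) (Q : probability Omega' R).
Variables (A : nat -> set nat) (Rel : nat -> 'cV[R]_p -> 'cV[R]_p -> Prop).
Variables (W Un : nat -> Omega -> 'cV[R]_p) (Z U : Omega' -> 'cV[R]_p).
Variables (f : 'cV[R]_p -> R) (M : R).
Hypothesis cf : continuous f.
Hypothesis fM : forall x, `|f x| <= M.

(* Upper [k]-Lipschitz envelope of the multivalued map sending [y] to the values
   [f u] with [Rel m y u], [m] in [A k]. *)
Let env_set k (x : 'cV[R]_p) : set R :=
  [set r | r = - M \/ exists m y u, [/\ A k m, Rel m y u & r = f u - k%:R * `|x - y|]].
Let env k x := sup (env_set k x).

Let M_ge0 : 0 <= M. Proof. exact: le_trans (fM 0). Qed.

Let f_le x : f x <= M. Proof. by have := fM x; rewrite ler_norml => /andP[]. Qed.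

Let f_ge x : - M <= f x. Proof. by have := fM x; rewrite ler_norml => /andP[]. Qed.

(** The default member [- M] keeps the supremum meaningful even when no pair is related. *)
Let env_set0 k x : env_set k x !=set0. Proof. by exists (- M); left. Qed.

Let env_ub k x : ubound (env_set k x) M.
Proof.
move=> r [->|[m [y [u [_ _ ->]]]]]; first by have := M_ge0; lra.
have : 0 <= k%:R * `|x - y| by rewrite mulr_ge0.
have := f_le u; lra.
Qed.

Let env_mem k x r : env_set k x r -> r <= env k x.
Proof. by move=> xr; apply: ub_le_sup => //; exists M; exact: env_ub. Qed.

Let env_norm k x : `|env k x| <= M.
Proof.
rewrite ler_norml; apply/andP; split; first by apply: env_mem; left.
by apply: ge_sup => //; exact: env_ub.
Qed.

Let env_lip k x x' : env k x <= env k x' + k%:R * `|x - x'|.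
Proof.
apply: ge_sup => // r [->|[m [y [u [Am Ru ->]]]]].
  have : - M <= env k x' by apply: env_mem; left.
  have : 0 <= k%:R * `|x - x'| by rewrite mulr_ge0.
  lra.
have : f u - k%:R * `|x' - y| <= env k x' by apply: env_mem; right; exists m, y, u.
have : k%:R * `|x' - y| <= k%:R * (`|x - x'| + `|x - y|).
  by rewrite ler_wpM2l// (distrC x x') ler_distD.
lra.
Qed.

Let env_continuous k : continuous (env k).
Proof.
move=> x; apply/(@cvgrPdist_lt _ R^o _ (nbhs x)) => e e0.
have k0 : 0 < k%:R + 1 :> R by rewrite ltr_wpDl.
near=> y.
have xy : `|x - y| < e / (k%:R + 1).
  near: y; apply/nbhs_ballP; exists (e / (k%:R + 1)); first by rewrite /= divr_gt0.
  by move=> y; rewrite -ball_normE.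
have : k%:R * `|x - y| < e.
  move: xy; rewrite ltr_pdivlMr// => xy.
  have := normr_ge0 (x - y); nra.
have := env_lip k x y; have := env_lip k y x; rewrite (distrC y x).
by rewrite ltr_norml => ? ? ?; apply/andP; split; lra.
Unshelve. all: by end_near. Qed.

Hypothesis A_decr : forall k l, (k <= l)%N -> A l `<=` A k.
Hypothesis mW : \forall n \near \oo, rand_mx (W n).
Hypothesis mUn : \forall n \near \oo, rand_mx (Un n).
Hypotheses (mZ : rand_mx Z) (mU : rand_mx U).
Hypothesis WZ : cvg_in_dist P W Q Z.
Hypothesis RelW : \forall n \near \oo, {ae P, forall w, Rel n (W n w) (Un n w)}.
Hypothesis RelZ : {ae Q, forall w, forall B, nbhs (U w) B ->
  exists k, \forall y \near Z w, forall m u, A k m -> Rel m y u -> B u}.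

(** Related pairs with [y] close to [Z w] have [f u] nearly at most [f (U w)] by [RelZ], and far
    ones are penalised away. Since only an upper bound is available, the maximum with [f (U w)]
    turns it into a limit. *)
Lemma env_cvg : {ae Q, forall w,
  (fun k => Num.max (env k (Z w)) (f (U w))) @ \oo --> f (U w)}.
Proof.
apply: filterS RelZ => w Rw; apply/cvgrPdist_le => e e0.
have [k0 kP] : exists k, \forall y \near Z w, forall m u,
    A k m -> Rel m y u -> f u < f (U w) + e.
  apply: (Rw [set u | f u < f (U w) + e]).
  by apply: (cvgr_lt (f (U w)) (@cf (U w))); rewrite ltrDl.
move/nbhs_ballP : kP => [de /= de0 kP].
near=> k.
have kk0 : (k0 <= k)%N by near: k; exact: nbhs_infty_ge.
(* With this [k], every [y] at distance at least [de] pays at least [2 * M], which brings its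
   contribution below [- M]. *)
have kM : 2 * M / de <= k%:R by near: k; exact: nbhs_infty_ger.
rewrite ler_pdivrMr// in kM.
suff : env k (Z w) <= f (U w) + e.
  move=> h; rewrite distrC ger0_norm ?subr_ge0 ?le_max ?lexx ?orbT// lerBlDl ge_max h/=.
  by rewrite lerDl ltW.
apply: ge_sup => // r [->|[m [y [u [Am Ru ->]]]]].
  by have := f_ge (U w); lra.
have [yZ|yZ] := ltP `|Z w - y| de.
  have := kP y; rewrite -ball_normE /= => /(_ yZ m u (A_decr kk0 Am) Ru).
  have : 0 <= k%:R * `|Z w - y| by rewrite mulr_ge0.
  lra.
have : k%:R * de <= k%:R * `|Z w - y| by rewrite ler_wpM2l.
by have := f_le u; have := f_ge (U w); lra.
Unshelve. all: by end_near. Qed.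

(* Extended continuous mapping theorem, one-sided: [Un n] need not be a function of
   [W n], only related to it. *)
Lemma relational_mapping e : 0 < e -> exists k, \forall n \near \oo, A k n ->
  (\int[P]_w (f (Un n w))%:E <= \int[Q]_w (f (U w))%:E + e%:E)%E.
Proof.
move=> e0.
have e20 : 0 < e / 2 by rewrite divr_gt0.
have mf X' : rand_mx X' -> measurable_fun setT (fun w : Omega' => f (X' w)).
  by move=> mX; exact: rand_mx_continuous.
have mfU := mf _ mU.
have menvZ k : measurable_fun setT (fun w => env k (Z w)).
  by apply: rand_mx_continuous => //; exact: env_continuous.
have mg k : measurable_fun setT (fun w => Num.max (env k (Z w)) (f (U w))).
  exact: measurable_maxr.
have gM k w : `|Num.max (env k (Z w)) (f (U w))| <= M.
  by rewrite /Num.max; case: ifP.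
have cg := bounded_expectation_cvg mg mfU gM env_cvg.
have fU := bounded_expectation_fin_num Q mfU (fun w => fM (U w)).
(* [k] is fixed before [n], so that [env k] is one bounded continuous function to which the
   convergence in law of [W] applies. *)
have [k kP] : exists k, (\int[Q]_w (Num.max (env k (Z w)) (f (U w)))%:E <
    \int[Q]_w (f (U w))%:E + (e / 2)%:E)%E.
  have h : (\int[Q]_w (f (U w))%:E < \int[Q]_w (f (U w))%:E + (e / 2)%:E)%E.
    by rewrite -[X in (X < _)%E]adde0 lteD2lE// lte_fin.
  by have [k _ /(_ k (leqnn k))] := cg _ (open_ereal_lt' h); exists k.
exists k.
have kZ : (\int[Q]_w (env k (Z w))%:E < \int[Q]_w (f (U w))%:E + (e / 2)%:E)%E.
  apply: le_lt_trans kP; apply: ae_le_expectation (menvZ k) (mg k) _ (gM k) _.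
    by move=> w; exact: env_norm.
  by apply: nearW => w; rewrite le_max lexx.
have cW : (\forall n \near \oo, \int[P]_w (env k (W n w))%:E <
    \int[Q]_w (f (U w))%:E + (e / 2)%:E)%E.
  apply: (WZ (@env_continuous k) _ (open_ereal_lt' kZ)).
  by exists M => x; exact: env_norm.
near=> n => An.
have mWn : rand_mx (W n) by near: n.
have mUnn : rand_mx (Un n) by near: n.
have ae : {ae P, forall w, Rel n (W n w) (Un n w)} by near: n.
apply: (@le_trans _ _ (\int[P]_w (env k (W n w))%:E)%E).
  apply: (@ae_le_expectation _ _ _ _ _ _ M).
  - exact: rand_mx_continuous.
  - by apply: rand_mx_continuous => //; exact: env_continuous.
  - by move=> w; exact: fM.
  - by move=> w; exact: env_norm.
  - apply: filterS ae => w Rw; apply: env_mem; right.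
    by exists n, (W n w), (Un n w); split => //; rewrite subrr normr0 mulr0 subr0.
apply: (@le_trans _ _ (\int[Q]_w (f (U w))%:E + (e / 2)%:E)%E).
  by apply: ltW; near: n.
by rewrite leeD2lE// lee_fin; lra.
Unshelve. all: by end_near. Qed.

End relational_mapping.

(** * Gram matrices, positive definiteness and Gaussian coordinates *)

Section linear_model.
Context {R : realType}.

Lemma mulmx_inj_unitmx p (M : 'M[R]_p) :
  (forall u : 'cV[R]_p, M *m u = 0 -> u = 0) -> M \in unitmx.
Proof.
move=> Minj; rewrite -unitmx_tr -row_free_unit; apply: inj_row_free => v vM.
apply: trmx_inj; rewrite trmx0; apply: Minj.
by apply: trmx_inj; rewrite trmx_mul trmxK trmx0 vM.
Qed.

Lemma sqnormE n (v : 'cV[R]_n) : (v^T *m v) ord0 ord0 = \sum_i v i ord0 ^+ 2.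
Proof. by rewrite mxE; apply: eq_bigr => i _; rewrite mxE expr2. Qed.

Lemma qform_gram n p (X : 'M[R]_(n, p)) (u : 'cV[R]_p) :
  qform (X^T *m X) u = \sum_i (X *m u) i ord0 ^+ 2.
Proof. by rewrite -sqnormE /qform trmx_mul !mulmxA. Qed.

(** Since [u' X' X u] is the squared norm of [X u], the kernel of [X' X] is that of [X], which is
    trivial by full rank. *)
Lemma gram_unitmx n p (X : 'M[R]_(n, p)) : \rank X = p -> X^T *m X \in unitmx.
Proof.
move=> rX; apply: mulmx_inj_unitmx => u XXu.
have Xu0 : X *m u = 0.
  apply/colP => i; rewrite [RHS]mxE.
  have : qform (X^T *m X) u = 0 by rewrite /qform -mulmxA XXu mulmx0 mxE.
  rewrite qform_gram => /eqP; rewrite psumr_eq0 => [/allP/(_ i)|j _]; last exact: sqr_ge0.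
  by rewrite mem_index_enum sqrf_eq0 => /(_ isT)/eqP.
have : row_free X^T by rewrite /row_free mxrank_tr rX.
move=> /mulmx_free_eq0 h; apply: trmx_inj; rewrite trmx0; apply/eqP.
by rewrite -h -trmx_mul Xu0 trmx0.
Qed.

Lemma posdef_unitmx p (C : 'M[R]_p) : posdef C -> C \in unitmx.
Proof.
move=> [_ Cpos]; apply: mulmx_inj_unitmx => u Cu.
have [//|/Cpos] := eqVneq u 0.
by rewrite /qform -mulmxA Cu mulmx0 mxE ltxx.
Qed.

(** With [a = C b], the form of the inverse at [a] equals the form of [C] at [b]. *)
Lemma qform_invmx_gt0 p (C : 'M[R]_p) (a : 'cV[R]_p) :
  posdef C -> a != 0 -> 0 < qform (invmx C) a.
Proof.
move=> Cpd a0; have Cu := posdef_unitmx Cpd; have [Csym Cpos] := Cpd.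
have aE : a = C *m (invmx C *m a) by rewrite mulKVmx.
have : invmx C *m a != 0.
  by apply: contra_neq a0 => b0; rewrite aE b0 mulmx0.
have qC b : qform (invmx C) (C *m b) = qform C b.
  by rewrite /qform trmx_mul Csym -mulmxA mulKmx.
by move=> /Cpos; rewrite -qC mulKVmx.
Qed.

Lemma qformZ p (C : 'M[R]_p) k (a : 'cV[R]_p) : qform (k *: C) a = k * qform C a.
Proof. by rewrite /qform -scalemxAr -scalemxAl mxE. Qed.

(** The coordinate is a linear form of [Z] with positive variance, and a nondegenerate normal law is
    absolutely continuous, hence has no atoms. *)
Lemma gaussian_vec_coord_null d (Omega : measurableType d) p
    (Q : probability Omega R) (Z : Omega -> 'cV[R]_p) (C : 'M[R]_p) (s : R) j c :
  posdef C -> 0 < s -> gaussian_vec Q Z (s ^+ 2 *: invmx C) ->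
  {ae Q, forall w, Z w j ord0 != c}.
Proof.
move=> Cpd s0 [mZ QZ]; pose a : 'cV[R]_p := delta_mx j ord0.
have aZ w : (a^T *m Z w) ord0 ord0 = Z w j ord0.
  by rewrite trmx_delta -rowE mxE.
have a0 : a != 0.
  by apply/negP => /eqP/matrixP/(_ j ord0); rewrite !mxE !eqxx => /eqP; rewrite oner_eq0.
have Sa : 0 < qform (s ^+ 2 *: invmx C) a.
  by rewrite qformZ mulr_gt0 ?exprn_gt0 ?qform_invmx_gt0.
exists ((fun w => (a^T *m Z w) ord0 ord0) @^-1` [set c]); split.
- rewrite -[X in measurable X]setTI; under eq_fun do rewrite aZ.
  exact: mZ.
- rewrite QZ// gt_eqF//.
  have /null_content_dominatesP := normal_prob_dominates (0 : R) (Num.sqrt (qform (s ^+ 2 *: invmx C) a)).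
  by apply => //; exact: lebesgue_measure_set1.
- by move=> w /= /negP; rewrite negbK aZ => /eqP.
Qed.

End linear_model.

(** * Rescaling the adaptive Lasso objective around the true parameter *)

Section adaptive_lasso_objective.
Context {R : realType}.

Lemma ls_est_linear_model n p (X : 'M[R]_(n, p)) (beta : 'cV[R]_p) (e : 'cV[R]_n) :
  \rank X = p ->
  ls_est X (X *m beta + e) = beta + invmx (X^T *m X) *m (X^T *m e).
Proof.
by move=> rX; rewrite /ls_est mulmxDr mulmxDr mulmxA mulKmx// gram_unitmx.
Qed.

(** Expressing [X' e] as [X' X W / sqrt n] shows that the increment depends on the errors only
    through [W], which is [sqrt n] times the least squares error. *)
Lemma al_obj_rescale n p (X : 'M[R]_(n, p)) (beta u : 'cV[R]_p) (e : 'cV[R]_n)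
    (lam : 'I_p -> R) (ls : R)
    (W := Num.sqrt n%:R *: (invmx (X^T *m X) *m (X^T *m e)))
    (C := n%:R^-1 *: (X^T *m X))
    (tau := fun j => Num.sqrt n%:R * beta j ord0) :
  \rank X = p -> (0 < n)%N -> 0 < ls ->
  al_obj X (X *m beta + e) lam (beta + Num.sqrt (ls / n%:R) *: u) =
  al_obj X (X *m beta + e) lam beta +
  ls * pen_quad C ((Num.sqrt ls)^-1 *: (C *m W))
    (fun j => 2 * lam j / (Num.sqrt ls * `|tau j + W j ord0|))
    (fun j => tau j / Num.sqrt ls) u.
Proof.
move=> rX n0 ls0.
have N0 : 0 < n%:R :> R by rewrite ltr0n.
have L0 : 0 < Num.sqrt ls by rewrite sqrtr_gt0.
have r0 : 0 < Num.sqrt n%:R :> R by rewrite sqrtr_gt0.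
have LE : ls = Num.sqrt ls ^+ 2 by rewrite sqr_sqrtr// ltW.
have rE : n%:R = Num.sqrt n%:R ^+ 2 :> R by rewrite sqr_sqrtr// ltW.
rewrite sqrtrM ?(ltW ls0)// sqrtrV ?(ltW N0)//.
have XW : X^T *m X *m W = Num.sqrt n%:R *: (X^T *m e).
  by rewrite /W -scalemxAr mulKVmx// gram_unitmx.
have lsE j : ls_est X (X *m beta + e) j ord0 = (tau j + W j ord0) / Num.sqrt n%:R.
  rewrite ls_est_linear_model// mxE /tau /W [in RHS]mxE -mulrDr mulrAC mulfV ?mul1r//.
  by rewrite gt_eqF.
set L := Num.sqrt ls in LE L0 *; set r := Num.sqrt n%:R in rE r0 XW lsE *.
have Ln := lt0r_neq0 L0; have rn := lt0r_neq0 r0.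
rewrite /al_obj /pen_quad.
have -> : \sum_(i < n) (X *m beta + e - X *m (beta + (L / r) *: u)) i ord0 ^+ 2 =
    \sum_(i < n) (X *m beta + e - X *m beta) i ord0 ^+ 2
    + (L / r) ^+ 2 * qform (X^T *m X) u
    - 2 * (L / r) * \sum_(j < p) (X^T *m e) j ord0 * u j ord0.
  have -> : X *m beta + e - X *m beta = e by rewrite addrC addKr.
  have -> : X *m beta + e - X *m (beta + (L / r) *: u) = e - (L / r) *: (X *m u).
    by rewrite mulmxDr -scalemxAr opprD addrA; congr (_ - _); rewrite addrC addKr.
  have -> : \sum_(j < p) (X^T *m e) j ord0 * u j ord0 =
      \sum_(i < n) e i ord0 * (X *m u) i ord0.
    have <- : (e^T *m (X *m u)) ord0 ord0 = \sum_(i < n) e i ord0 * (X *m u) i ord0.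
      by rewrite mxE; apply: eq_bigr => i _; rewrite [in LHS]mxE.
    rewrite mulmxA mxE; apply: eq_bigr => j _; congr (_ * _).
    by rewrite -[e^T *m X]trmxK trmx_mul trmxK [RHS]mxE.
  rewrite qform_gram !mulr_sumr -big_split -sumrB /=; apply: eq_bigr => i _.
  by move: (X *m u) => v; rewrite !mxE; ring.
have -> : \sum_j (L^-1 *: (C *m W)) j ord0 * u j ord0 =
    (L * r)^-1 * \sum_(j < p) (X^T *m e) j ord0 * u j ord0.
  rewrite mulr_sumr; apply: eq_bigr => j _.
  rewrite /C -scalemxAl XW rE [in LHS]mxE [X in _ * X * _]mxE [X in _ * (_ * X) * _]mxE.
  by field; rewrite Ln rn.
rewrite /C qformZ rE LE.
have : \sum_j lam j * `|(beta + (L / r) *: u) j ord0| /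
      `|ls_est X (X *m beta + e) j ord0| =
    \sum_j lam j * `|beta j ord0| / `|ls_est X (X *m beta + e) j ord0| +
    L ^+ 2 / 2 * \sum_j 2 * lam j / (L * `|tau j + W j ord0|) *
      (`|u j ord0 + tau j / L| - `|tau j / L|).
  rewrite mulr_sumr -big_split /=; apply: eq_bigr => j _.
  have bE : beta j ord0 = (L / r) * (tau j / L) by rewrite /tau -/r; field; rewrite Ln rn.
  have -> : (beta + (L / r) *: u) j ord0 = (L / r) * (u j ord0 + tau j / L).
    by rewrite mxE {1}bE [(_ *: u) _ _]mxE; ring.
  rewrite {1}bE lsE !(normrM (L / r)) (normrM (_ + W _ _)) (ger0_norm (ltW (divr_gt0 L0 r0))).
  rewrite (@ger0_norm _ r^-1) ?invr_ge0 ?(ltW r0)//.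
  (* At a vanishing least squares coordinate, division by zero yields 0 and the penalty terms of
     both sides vanish. *)
  have [->|h] := eqVneq `|tau j + W j ord0| 0.
    by rewrite mul0r mulr0 !invr0 !mulr0 mul0r mulr0 addr0.
  by field; rewrite Ln rn h.
move=> ->.
by field; rewrite Ln rn.
Qed.

End adaptive_lasso_objective.

(** * Limits of weights and shifts, and separation from zero along an ultrafilter *)

Section penalty_limits.
Context {R : realType}.

(** The ratio is the reciprocal of [psi_seq], whose value [+oo] at [lam = 0] matches the ratio 0. *)
Lemma psi_seq_cvgy_ratio (ls lam : nat -> R) :
  (forall n, 0 <= lam n) -> ls @ \oo --> +oo ->
  (fun n => psi_seq (ls n) (lam n)) @ \oo --> +oo%E ->
  (fun n => lam n / Num.sqrt (ls n)) @ \oo --> 0.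
Proof.
move=> lam0 lsy /cvgeyPgt psiy; apply/cvgrPdist_lt => e e0; near=> n.
have ls0 : 0 < ls n by near: n; exact: (cvgryPgt _).1.
have L0 : 0 < Num.sqrt (ls n) by rewrite sqrtr_gt0.
have : ((e^-1)%:E < psi_seq (ls n) (lam n))%E by near: n; exact: psiy.
rewrite /psi_seq sub0r normrN (ger0_norm (divr_ge0 (lam0 n) (ltW L0))).
have [->|ln] := eqVneq (lam n) 0; first by rewrite mul0r.
have ln0 : 0 < lam n by rewrite lt0r ln lam0.
rewrite lte_fin ltr_pdivlMr// ltr_pdivrMr// mulrC ltr_pdivrMr//.
by rewrite mulrC.
Unshelve. all: by end_near. Qed.

(* In the notation of the paper [tau = sqrt n * beta_n], so that
   [phi = lim tau * sqrt ls / lam] and, when [lam > 0], the weight [w] is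
   [2 / `|tau * sqrt ls / lam + sqrt ls / lam * y|]. *)
Lemma weight_limits {T : Type} (F : set_system T) {FF : Filter F} (k : T -> nat)
    (y : T -> R) (ls lam tau : nat -> R) (l0 z de : R) (psi phi : \bar R)
    (sing := (phi == 0%E) && (psi == 0%E))
    (flat := [|| phi == +oo%E, phi == -oo%E | psi == +oo%E])
    (w := fun t => 2 * lam (k t) / (Num.sqrt (ls (k t)) * `|tau (k t) + y t|))
    (a := fun t => tau (k t) / Num.sqrt (ls (k t))) :
  k @ F --> \oo -> y @ F --> z ->
  (forall n, 0 <= lam n) ->
  (\forall n \near \oo, 0 < lam n) \/ (\forall n \near \oo, lam n = 0) ->
  ls @ \oo --> +oo ->
  (fun n => lam n / ls n) @ \oo --> l0 ->
  (fun n => psi_seq (ls n) (lam n)) @ \oo --> psi ->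
  ((\forall n \near \oo, 0 < lam n) ->
    (fun n => (tau n * Num.sqrt (ls n) / lam n)%:E) @ \oo --> phi) ->
  0 < de -> (\forall t \near F, de <= `|tau (k t) + y t|) ->
  (fine psi != 0 -> fine phi + fine psi * z != 0) ->
  if sing then [/\ \forall t \near F, 0 < w t, (w t)^-1 @[t --> F] --> 0
                 & a @ F --> 0]
  else w @ F --> (if flat then 0 else 2 / `|fine phi + fine psi * z|) /\
       (flat \/ a @ F --> l0 * fine phi).
Proof.
move=> koo yz lam0 lam_dich lsy lamls psic phic de0 far nondeg.
have kF (A : set nat) : (\forall n \near \oo, A n) -> \forall t \near F, A (k t).
  by move=> /koo.
have kc (f : nat -> R) (l : R) : f @ \oo --> l -> f (k t) @[t --> F] --> l.
  by move=> fl; exact: (cvg_comp _ _ koo fl).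
have lspos : \forall n \near \oo, 0 < ls n by exact: (cvgryPgt _).1.
have [psiy|psiy] := eqVneq psi +oo%E.
  have singN : sing = false by rewrite /sing psiy andbF.
  have flatT : flat by rewrite /flat psiy eqxx !orbT.
  rewrite singN flatT; split; last by left.
  rewrite psiy in psic.
  have /kc r0 := psi_seq_cvgy_ratio lam0 lsy psic.
  (* The separation [de <= |tau + y|] bounds the weight by [2 / de] times the ratio
     [lam / sqrt ls]. *)
  apply: (@squeeze_cvgr _ _ _ _ (fun=> 0)
    (fun t => (2 / de) * (lam (k t) / Num.sqrt (ls (k t))))).
  - near=> t.
    have ls0 : 0 < ls (k t) by near: t; exact: (kF _ lspos).
    have det : de <= `|tau (k t) + y t| by near: t.
    have L0 : 0 < Num.sqrt (ls (k t)) by rewrite sqrtr_gt0.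
    have lamt := lam0 (k t).
    have abs0 := lt_le_trans de0 det.
    rewrite /w divr_ge0 ?mulr_ge0 ?(ltW L0)//=.
    have -> : 2 / de * (lam (k t) / Num.sqrt (ls (k t))) =
      2 * lam (k t) / (Num.sqrt (ls (k t)) * de) by field; rewrite !gt_eqF.
    apply: ler_wpM2l; first by rewrite mulr_ge0.
    by rewrite lef_pV2 ?posrE ?mulr_gt0// ler_pM2l.
  - exact: cvg_cst.
  - by rewrite -(mulr0 (2 / de)); apply: cvgM => //; exact: cvg_cst.
have lampos : \forall n \near \oo, 0 < lam n.
  case: lam_dich => // lamz; exfalso; move/eqP: psiy; apply.
  apply/esym; apply: (cvg_unique _ _ psic); first exact: ereal_hausdorff.
  apply: cvg_near_cst; near=> n.
  have -> : lam n = 0 by near: n.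
  by rewrite /psi_seq eqxx.
have {}phic := phic lampos.
pose ps n := Num.sqrt (ls n) / lam n.
pose th n := tau n * Num.sqrt (ls n) / lam n.
have psic' : (fun n => (ps n)%:E) @ \oo --> psi.
  apply: cvg_trans psic; apply: near_eq_cvg; near=> n.
  have ln : 0 < lam n by near: n.
  by rewrite /psi_seq gt_eqF.
have psiNy : psi != -oo%E.
  apply/negP => /eqP psiE; rewrite psiE in psic'.
  have /cvgeNyPlt/(_ 0) h := psic'.
  have [n [/=]] := filter_ex (filterI h lampos).
  by rewrite lte_fin /ps ltNge divr_ge0.
have [r psiE] : exists r, psi = r%:E by case: psi psiy psiNy {sing flat psic phic nondeg psic'} => // r; exists r.
have psr : ps @ \oo --> r by move: psic'; rewrite psiE => /fine_cvgP[].
have den_w : \forall t \near F, w t = 2 / `|th (k t) + ps (k t) * y t|.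
  near=> t.
  have ls0 : 0 < ls (k t) by near: t; exact: (kF _ lspos).
  have L0 : 0 < Num.sqrt (ls (k t)) by rewrite sqrtr_gt0.
  have lamt : 0 < lam (k t) by near: t; exact: (kF _ lampos).
  have det : de <= `|tau (k t) + y t| by near: t.
  have abs0 := lt_le_trans de0 det.
  have -> : th (k t) + ps (k t) * y t =
      Num.sqrt (ls (k t)) / lam (k t) * (tau (k t) + y t).
    by rewrite /th /ps; field; rewrite gt_eqF.
  rewrite normrM (ger0_norm (ltW (divr_gt0 L0 lamt))) /w.
  by field; rewrite !gt_eqF.
have psy : ps (k t) * y t @[t --> F] --> r * z by apply: cvgM => //; exact: kc.
have [phiinf|phifin] := boolP ((phi == +oo%E) || (phi == -oo%E)).
  have flatT : flat by rewrite /flat orbA phiinf.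
  have singN : sing = false by rewrite /sing; case/orP: phiinf => /eqP->.
  rewrite singN flatT; split; last by left.
  (* For infinite [phi], [|th|] tends to infinity while [ps * y] stays bounded, so the denominator
     of the weight diverges. *)
  have thy A : \forall n \near \oo, A < `|th n|.
    case/orP: phiinf => /eqP phiE; rewrite phiE in phic.
      have /cvgeyPgt/(_ A) := phic; apply: filterS => n /=.
      by rewrite lte_fin => /lt_le_trans; apply; exact: ler_norm.
    have /cvgeNyPlt/(_ (- A)) := phic; apply: filterS => n /=.
    by rewrite lte_fin -ltrN2 opprK => /lt_le_trans; apply; rewrite -normrN; exact: ler_norm.
  apply/cvgrPdist_lt => e e0; near=> t.
  have -> : w t = 2 / `|th (k t) + ps (k t) * y t| by near: t.
  have tht : 2 / e + (`|r * z| + 1) < `|th (k t)| by near: t; exact: (kF _ (thy _)).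
  have pst : `|ps (k t) * y t| < `|r * z| + 1.
    by near: t; apply: (cvgr_norm_lt _ psy); rewrite ltrDl.
  have big : 2 / e < `|th (k t) + ps (k t) * y t|.
    have := lerB_normD (th (k t)) (ps (k t) * y t); lra.
  have big0 : 0 < `|th (k t) + ps (k t) * y t|.
    by apply: lt_trans big; rewrite divr_gt0.
  rewrite sub0r normrN ger0_norm ?divr_ge0//.
  by rewrite ltr_pdivrMr// mulrC -ltr_pdivrMr.
have [f phiE] : exists f, phi = f%:E.
  by case: phi phifin {sing flat psic phic nondeg psic'} => // f; exists f.
have flatF : flat = false by rewrite /flat orbA (negbTE phifin) (negbTE psiy).
have thf : th @ \oo --> f by move: phic; rewrite phiE => /fine_cvgP[].
have denc : th (k t) + ps (k t) * y t @[t --> F] --> f + r * z.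
  by apply: cvgD => //; exact: kc.
have ac : a @ F --> l0 * f.
  have : (fun t => (lam (k t) / ls (k t)) * th (k t)) @ F --> l0 * f.
    by apply: cvgM; [exact: (kc (fun n => lam n / ls n))|exact: kc].
  apply: cvg_trans; apply: near_eq_cvg; near=> t.
  have ls0 : 0 < ls (k t) by near: t; exact: (kF _ lspos).
  have L0 : 0 < Num.sqrt (ls (k t)) by rewrite sqrtr_gt0.
  have lamt : 0 < lam (k t) by near: t; exact: (kF _ lampos).
  rewrite /th /a -{1}[ls (k t)]sqr_sqrtr ?(ltW ls0)//.
  by field; rewrite !gt_eqF.
rewrite flatF /sing; case: ifPn => [/andP[/eqP ph0 /eqP ps0]|nsing].
  have f0 : f = 0 by move: ph0; rewrite phiE => -[].
  have r0 : r = 0 by move: ps0; rewrite psiE => -[].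
  rewrite f0 mulr0 in ac; split => //.
    near=> t.
    have ls0 : 0 < ls (k t) by near: t; exact: (kF _ lspos).
    have lamt : 0 < lam (k t) by near: t; exact: (kF _ lampos).
    have det : de <= `|tau (k t) + y t| by near: t.
    by rewrite /w !(divr_gt0, mulr_gt0) ?sqrtr_gt0// (lt_le_trans de0).
  rewrite f0 r0 mul0r addr0 in denc.
  have : (fun t => `|th (k t) + ps (k t) * y t| / 2) @ F --> `|0 : R| / 2.
    by apply: cvgM; [exact: cvg_norm|exact: cvg_cst].
  rewrite normr0 mul0r; apply: cvg_trans; apply: near_eq_cvg; near=> t.
  have -> : w t = 2 / `|th (k t) + ps (k t) * y t| by near: t.
  by rewrite invf_div.
rewrite phiE psiE /=; split; last by right.
(* For [r != 0] this is the nondegeneracy assumption; for [r = 0], the pair being nonsingular gives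
   [f != 0]. *)
have frz : f + r * z != 0.
  move: nondeg nsing; rewrite phiE psiE /= !eqe; have [->|r0 /(_ isT)//] := eqVneq r 0.
  by rewrite andbT mul0r addr0.
have : (fun t => 2 / `|th (k t) + ps (k t) * y t|) @ F --> 2 / `|f + r * z|.
  apply: cvgM; first exact: cvg_cst.
  by apply: cvgV; [rewrite normr_eq0|exact: cvg_norm].
by apply: cvg_trans; apply: near_eq_cvg; apply: filterS den_w => t ->.
Unshelve. all: by end_near. Qed.

(* Either [tau] is bounded along [G], and [- c] is its limit, or it tends to infinity in
   norm along [G]. *)
Lemma ultra_separation (G : set_system nat) (tau : nat -> R) : UltraFilter G ->
  exists (c : R) (B : nat -> set nat),
    [/\ forall k, G (B k), forall k l, (k <= l)%N -> B l `<=` B k &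
        forall z, z != c -> exists de k, 0 < de /\
          forall m, B k m -> de <= `|tau m + z|].
Proof.
move=> GU.
have [[M GM]|nb] := pselect (exists M, \forall m \near G, `|tau m| <= M).
  have [c tauc] := ultra_bounded_cvg GU GM.
  exists (- c), (fun k => [set m | `|c - tau m| < k.+1%:R^-1]); split.
  - by move=> k; have /cvgrPdist_lt := tauc; apply; rewrite invr_gt0.
  - move=> k l kl m /= h; apply: (lt_le_trans h).
    by rewrite lef_pV2 ?posrE// ler_nat.
  - move=> z zc; pose de := `|z + c| / 2.
    have de0 : 0 < de by rewrite divr_gt0// normr_gt0 addr_eq0.
    have [k _ /(_ k (leqnn k)) kde] := nbhs_infty_gtr de^-1.
    exists de, k; split => // m /= cm.
    have : k.+1%:R^-1 < de.
      rewrite invf_plt ?posrE//.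
      by apply: (lt_trans kde); rewrite ltr_nat.
    move=> /(lt_trans cm) {}cm.
    have := ler_normD (tau m + z) (c - tau m).
    have -> : tau m + z + (c - tau m) = z + c by ring.
    have : `|z + c| = de + de by rewrite /de; lra.
    lra.
exists 0, (fun k => [set m | k%:R < `|tau m|]); split.
- move=> k; have [//|h] := in_ultra_setVsetC [set m | k%:R < `|tau m|] GU.
  exfalso; apply: nb; exists k%:R; apply: filterS h => m /= /negP.
  by rewrite -leNgt.
- by move=> k l kl m /=; apply: le_lt_trans; rewrite ler_nat.
- move=> z _; have [k _ /(_ k (leqnn k)) kz] := nbhs_infty_gtr (`|z| + 1).
  exists 1, k; split => // m /= km.
  by have := lerB_normD (tau m) z; lra.
Qed.

End penalty_limits.

(** * The limit objective as a penalised quadratic under linear constraints *)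

Section limit_objective.
Context {R : realType}.

Definition singular_penalty (phi psi : \bar R) : bool := (phi == 0%E) && (psi == 0%E).

(* On singular indices the infinite penalty is encoded by the constraint [u j = 0], and
   the weight is set to 0. *)
Definition limit_weight (phi psi : \bar R) (z : R) : R :=
  if singular_penalty phi psi || [|| phi == +oo%E, phi == -oo%E | psi == +oo%E] then 0
  else 2 / `|fine phi + fine psi * z|.

Lemma limit_weight_ge0 phi psi z : 0 <= limit_weight phi psi z.
Proof. by rewrite /limit_weight; case: ifP => // _; rewrite divr_ge0. Qed.

Lemma A_phi_pen l0 (phi psi : \bar R) z u : (singular_penalty phi psi -> u = 0) ->
  A_phi l0 phi psi z u =
  (limit_weight phi psi z * (`|u + l0 * fine phi| - `|l0 * fine phi|))%:E.
Proof.
move=> su; rewrite /A_phi /limit_weight.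
have [->|u0] := eqVneq u 0; first by rewrite /= add0r subrr mulr0.
rewrite -/(singular_penalty phi psi); have [/su uE|ns] := boolP (singular_penalty phi psi).
  by rewrite uE eqxx in u0.
rewrite /= -orbA; case: ifP => _; first by rewrite mul0r.
by congr (_%:E); ring.
Qed.

Lemma A_phi_singular l0 (phi psi : \bar R) z u : singular_penalty phi psi -> u != 0 ->
  A_phi l0 phi psi z u = +oo%E.
Proof.
by move=> /andP[/eqP-> /eqP->] /negbTE u0; rewrite /A_phi u0 /= !eqxx.
Qed.

Variables (p : nat) (C : 'M[R]_p) (l0 : 'I_p -> R) (phi psi : 'I_p -> \bar R).
Variable z : 'cV[R]_p.

Let S j := singular_penalty (phi j) (psi j).
Let w j := limit_weight (phi j) (psi j) (z j ord0).
Let a j := l0 j * fine (phi j).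

Lemma V_phi_pen (v : 'cV[R]_p) : (forall j, S j -> v j ord0 = 0) ->
  V_phi C l0 phi psi z v = (pen_quad C 0 w a v)%:E.
Proof.
move=> Sv; rewrite /V_phi /pen_quad.
rewrite [X in 2 * X]big1 ?mulr0 ?subr0 => [|j _]; last by rewrite mxE mul0r.
rewrite EFinD -sumEFin; congr (_ + _)%E; apply: eq_bigr => j _.
by rewrite A_phi_pen// => /Sv.
Qed.

(** [V_phi] is finite at 0, so a minimiser cannot violate a constraint; on the constrained subspace
    [V_phi] is a real-valued [pen_quad]. *)
Lemma argmin_V_phi (u : 'cV[R]_p) : is_argmin_e (V_phi C l0 phi psi z) u ->
  (forall j, S j -> u j ord0 = 0) /\
  forall v : 'cV[R]_p, (forall j, S j -> v j ord0 = 0) ->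
    pen_quad C 0 w a u <= pen_quad C 0 w a v.
Proof.
move=> umin.
have Su j : S j -> u j ord0 = 0.
  move=> Sj; have [//|uj] := eqVneq (u j ord0) 0.
  have := umin 0; rewrite (@V_phi_pen 0) => [|i _]; last by rewrite mxE.
  rewrite /V_phi (_ : (\sum_(i < p) _)%E = +oo%E) ?addey ?leye_eq//.
  apply/esum_eqyP; last by exists j; split=> //; exact: A_phi_singular.
  by move=> i _; rewrite /A_phi; case: (_ || _) => //; case: (_ && _).
by split=> // v Sv; have := umin v; rewrite !V_phi_pen.
Qed.

End limit_objective.

(** * Convergence of the rescaled minimisers for deterministic arguments *)

Section rescaled_argmin.
Context {R : realType} {p : nat}.
Variables (C : 'M[R]_p) (C_ : nat -> 'M[R]_p) (ls : nat -> R).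
Variables (lam tau : nat -> 'I_p -> R) (l0 : 'I_p -> R) (phi psi : 'I_p -> \bar R).

Definition rescaled_obj n (y : 'cV[R]_p) : 'cV[R]_p -> R :=
  pen_quad (C_ n) ((Num.sqrt (ls n))^-1 *: (C_ n *m y))
    (fun j => 2 * lam n j / (Num.sqrt (ls n) * `|tau n j + y j ord0|))
    (fun j => tau n j / Num.sqrt (ls n)).

Hypothesis Cpos : forall u : 'cV[R]_p, u != 0 -> 0 < qform C u.
Hypothesis C_ge0 : forall n (u : 'cV[R]_p), 0 <= qform (C_ n) u.
Hypothesis C_cvg : C_ @ \oo --> C.
Hypothesis lam_ge0 : forall n j, 0 <= lam n j.
Hypothesis lam_dich : forall j,
  (\forall n \near \oo, 0 < lam n j) \/ (\forall n \near \oo, lam n j = 0).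
Hypothesis lsy : ls @ \oo --> +oo.
Hypothesis lam_cvg : forall j, (fun n => lam n j / ls n) @ \oo --> l0 j.
Hypothesis psi_cvg : forall j, (fun n => psi_seq (ls n) (lam n j)) @ \oo --> psi j.
Hypothesis phi_cvg : forall j, (\forall n \near \oo, 0 < lam n j) ->
  (fun n => (tau n j * Num.sqrt (ls n) / lam n j)%:E) @ \oo --> phi j.

Lemma inv_sqrt_cvg0 : (fun n => (Num.sqrt (ls n))^-1) @ \oo --> 0.
Proof.
apply/cvgrPdist_lt => e e0; near=> n.
have big : e^-1 ^+ 2 < ls n by near: n; exact: ((cvgryPgt _).1 lsy).
have ls0 : 0 < ls n by rewrite (le_lt_trans _ big)// sqr_ge0.
rewrite sub0r normrN ger0_norm ?invr_ge0 ?sqrtr_ge0//.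
rewrite invf_plt ?posrE ?sqrtr_gt0//.
have : Num.sqrt (e^-1 ^+ 2) < Num.sqrt (ls n) by rewrite ltr_sqrt.
by rewrite sqrtr_sqr ger0_norm// invr_ge0 ltW.
Unshelve. all: by end_near. Qed.

(** The stability of minimisers is applied along the product of the filter generated by the sets
    [A k] with the neighbourhoods of [z], which makes the convergence joint in the index and in
    [y]. *)
Lemma rescaled_argmin_near (A : nat -> set nat) (z u0 : 'cV[R]_p) :
  (forall k l, (k <= l)%N -> A l `<=` A k) ->
  (forall k m, A k m -> (k <= m)%N) ->
  (forall j, exists de k, 0 < de /\
     forall m, A k m -> de <= `|tau m j + z j ord0|) ->
  (forall j, fine (psi j) != 0 -> fine (phi j) + fine (psi j) * z j ord0 != 0) ->
  is_argmin_e (V_phi C l0 phi psi z) u0 ->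
  forall B, nbhs u0 B -> exists k, \forall y \near z, forall m u,
    A k m -> is_argmin (rescaled_obj m y) u -> B u.
Proof.
move=> A_decr A_ge sep nondeg /argmin_V_phi[Su0 u0min] B /nbhs_ballP[e /= e0 eB].
pose FA : set_system nat := filter_from setT A.
have FAF : Filter FA.
  apply: filter_from_filter; first by exists 0%N.
  move=> i j _ _; exists (maxn i j) => // m Am.
  by split; apply: A_decr Am; rewrite ?leq_maxl ?leq_maxr.
have FAoo : FA --> \oo.
  by move=> D [N _ ND]; exists N => // m /A_ge; exact: ND.
pose F : set_system (nat * 'cV[R]_p) := filter_prod FA (nbhs z).
have FF : Filter F by exact: filter_prod_filter.
have fstoo : (fun t : nat * 'cV[R]_p => t.1) @ F --> \oo.
  by apply: cvg_trans FAoo; exact: cvg_fst.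
have ycvg j : (fun t : nat * 'cV[R]_p => t.2 j ord0) @ F --> z j ord0.
  apply: (@cvg_comp _ _ _ (fun t : nat * 'cV[R]_p => t.2)
    (fun M : 'cV[R]_p => M j ord0) _ (nbhs z)); first exact: cvg_snd.
  exact: (@coord_continuous _ _ _ j ord0 z).
have Ccvg i j : (fun t : nat * 'cV[R]_p => C_ t.1 i j) @ F --> C i j.
  have Cij : (fun n => C_ n i j) @ \oo --> C i j.
    exact: (cvg_comp C_ (fun M : 'M[R]_p => M i j) C_cvg (@coord_continuous _ _ _ i j C)).
  exact: (cvg_comp _ _ fstoo Cij).
pose c (t : nat * 'cV[R]_p) j := tau t.1 j + t.2 j ord0.
(* Half of the separation at [z] survives for all [y] whose coordinate [j] is within [de / 2] of
   that of [z]. *)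
have wl j : exists de, 0 < de /\ \forall t \near F, de <= `|c t j|.
  have [de [k [de0 dk]]] := sep j.
  exists (de / 2); split; first by rewrite divr_gt0.
  have near1 : \forall t \near F, de <= `|c (t.1, z) j|.
    exists (A k, setT); first by split; [exists k|exact: filterT].
    by move=> [m y] [/= Am _]; exact: dk.
  have near2 : \forall t \near F, `|z j ord0 - (t : nat * 'cV[R]_p).2 j ord0| < de / 2.
    by have /cvgrPdist_lt := ycvg j; apply; rewrite divr_gt0.
  near=> t.
  have h1 : de <= `|c (t.1, z) j| by near: t.
  rewrite /c /= in h1.
  have h2 : `|z j ord0 - t.2 j ord0| < de / 2 by near: t.
  have := ler_normD (tau t.1 j + t.2 j ord0) (z j ord0 - t.2 j ord0).
  rewrite -/(c t j).
  have -> : c t j + (z j ord0 - t.2 j ord0) = tau t.1 j + z j ord0 by rewrite /c; ring.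
  lra.
pose w (t : nat * 'cV[R]_p) j :=
  2 * lam t.1 j / (Num.sqrt (ls t.1) * `|tau t.1 j + t.2 j ord0|).
pose a (t : nat * 'cV[R]_p) j := tau t.1 j / Num.sqrt (ls t.1).
have wlim j : if singular_penalty (phi j) (psi j)
    then [/\ \forall t \near F, 0 < w t j, (w t j)^-1 @[t --> F] --> 0
           & a t j @[t --> F] --> 0]
    else w t j @[t --> F] --> limit_weight (phi j) (psi j) (z j ord0) /\
         (limit_weight (phi j) (psi j) (z j ord0) = 0 \/
          a t j @[t --> F] --> l0 j * fine (phi j)).
  have [de [de0 far]] := wl j.
  have := weight_limits fstoo (ycvg j) (fun n => lam_ge0 n j) (@lam_dich j) lsy
    (@lam_cvg j) (@psi_cvg j) (@phi_cvg j) de0 far (@nondeg j).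
  rewrite -/(singular_penalty _ _) /limit_weight.
  case: (singular_penalty _ _) => /= /(_ FF) //.
  by move=> [wc [fl|ac]]; split => //; [left; rewrite fl|right].
have h : \forall t \near F, forall u, is_argmin (rescaled_obj (t : nat * 'cV[R]_p).1 t.2) u ->
    forall j, `|u j ord0 - u0 j ord0| < e.
  apply: (@pen_quad_argmin_near _ _ F _ p C (fun t => C_ t.1)
    (fun t => (Num.sqrt (ls t.1))^-1 *: (C_ t.1 *m t.2)) w a
    (fun j => limit_weight (phi j) (psi j) (z j ord0))
    (fun j => l0 j * fine (phi j))
    (fun j => singular_penalty (phi j) (psi j)) u0) => //.
  - move=> j; rewrite (_ : (fun t => _) = fun t : nat * 'cV[R]_p =>
      (Num.sqrt (ls t.1))^-1 * \sum_k C_ t.1 j k * t.2 k ord0); last first.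
      by apply/funext => t; rewrite mxE [X in _ * X]mxE.
    rewrite -[X in _ --> X](mul0r (\sum_k C j k * z k ord0)); apply: cvgM.
      exact: (cvg_comp (fun t : nat * 'cV[R]_p => t.1) (fun n => (Num.sqrt (ls n))^-1) fstoo inv_sqrt_cvg0).
    by apply: cvg_sumr => k _; apply: cvgM; [exact: Ccvg|exact: ycvg].
  - by move=> t j; rewrite divr_ge0 ?mulr_ge0 ?sqrtr_ge0.
  - by move=> j nS; have := wlim j; rewrite (negbTE nS) => -[].
  - by move=> j nS; have := wlim j; rewrite (negbTE nS) => -[].
  - by move=> j jS; have := wlim j; rewrite jS => -[].
  - by move=> j jS; have := wlim j; rewrite jS => -[].
  - by move=> j jS; have := wlim j; rewrite jS => -[].
  - by move=> j jS; rewrite /limit_weight jS.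
  - by move=> j; exact: limit_weight_ge0.
have [[B1 B2] [/= [k _ AB] zB] BF] := h.
exists k; apply: filterS zB => y B2y m u Am um.
apply: eB; rewrite -ball_normE /= [ltLHS]mx_normrE; apply: bigmax_lt => // -[i j] _ /=.
rewrite !mxE (ord1 j) distrC.
by apply: (BF (m, y)) => //; split => //; exact: AB.
Unshelve. all: by end_near. Qed.

End rescaled_argmin.

(** * Convergence in distribution of the rescaled adaptive Lasso estimator *)

Lemma rand_mx_mulmx (R : realType) d (Omega : measurableType d) m n p
    (M : 'M[R]_(m, n)) (e : Omega -> 'M[R]_(n, p)) :
  rand_mx e -> rand_mx (fun w => M *m e w).
Proof.
move=> me i j; under eq_fun do rewrite mxE.
by apply: measurable_sum => k; apply: measurable_funM => //; exact: me.
Qed.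

Lemma argmin_affine_rescale (R : realType) p (g h : 'cV[R]_p -> R)
    (b v : 'cV[R]_p) (c l s : R) :
  0 < l -> s != 0 -> (forall u, g (b + s *: u) = c + l * h u) ->
  is_argmin g v -> is_argmin h (s^-1 *: (v - b)).
Proof.
move=> l0 s0 gh vmin u; have := vmin (b + s *: u).
have {1}-> : v = b + s *: (s^-1 *: (v - b)) by rewrite scalerA divff// scale1r subrKC.
by rewrite !gh lerD2l ler_pM2l.
Qed.

Theorem theorem3 (R : realType) (p : nat)
  (d : measure_display) (Omega : measurableType d) (P : probability Omega R)
  (X : forall n : nat, 'M[R]_(n, p)) (sigma : R) (e : forall n : nat, Omega -> 'cV[R]_n)
  (C : 'M[R]_p) (lam : nat -> 'I_p -> R) (lam0 : 'I_p -> R) (psi phi : 'I_p -> \bar R)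
  (beta : nat -> 'cV[R]_p) (bAL : nat -> Omega -> 'cV[R]_p)
  (d' : measure_display) (Omega' : measurableType d') (Q : probability Omega' R)
  (Z U : Omega' -> 'cV[R]_p) :
  (* model *)
  (forall n, (p <= n)%N -> \rank (X n) = p) ->
  0 < sigma ->
  (forall n, (p <= n)%N -> iid_errors P (e n) sigma) ->
  (fun n => n%:R^-1 *: ((X n)^T *m X n)) @ \oo --> C ->
  posdef C ->
  gaussian_vec Q Z (sigma ^+ 2 *: invmx C) ->
  cvg_in_dist P (fun n w => Num.sqrt n%:R *: (invmx ((X n)^T *m X n) *m ((X n)^T *m e n w))) Q Z ->
  (forall n, (p <= n)%N -> forall (b : 'cV[R]_p) (j : 'I_p),
     P [set w | ls_est (X n) (X n *m b + e n w) j ord0 = 0] = 0%E) ->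
  (* tuning parameters *)
  (forall n j, 0 <= lam n j) ->
  (forall j, (\forall n \near \oo, 0 < lam n j) \/ (\forall n \near \oo, lam n j = 0)) ->
  (fun n => lam_star (lam n) / n%:R) @ \oo --> 0 ->
  (fun n => lam_star (lam n)) @ \oo --> +oo ->
  (forall j, (fun n => lam n j / lam_star (lam n)) @ \oo --> lam0 j) ->
  (forall j, (fun n => psi_seq (lam_star (lam n)) (lam n j)) @ \oo --> psi j) ->
  (* local parameters *)
  (forall j, (\forall n \near \oo, 0 < lam n j) ->
     (fun n => (Num.sqrt n%:R * beta n j ord0 * Num.sqrt (lam_star (lam n)) / lam n j)%:E)
       @ \oo --> phi j) ->
  (* the adaptive Lasso under P_{beta_n} *)
  (forall n, (p <= n)%N -> rand_mx (bAL n)) ->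
  (forall n, (p <= n)%N -> forall w,
     (forall j, ls_est (X n) (X n *m beta n + e n w) j ord0 != 0) ->
     is_argmin (al_obj (X n) (X n *m beta n + e n w) (lam n)) (bAL n w)) ->
  (* the limit: argmin of V_phi *)
  rand_mx U ->
  {ae Q, forall w, is_argmin_e (V_phi C lam0 phi psi (Z w)) (U w)} ->
  cvg_in_dist P (fun n w => Num.sqrt (n%:R / lam_star (lam n)) *: (bAL n w - beta n)) Q U.
Proof.
move=> rX s0 iid Xcvg Cpd gZ WZ LS0 lam_ge0 lamd _ lsy lamc psic phic mbAL bALmin mU Umin f cf [M fM].
pose ls n := lam_star (lam n).
pose gram n := (X n)^T *m X n.
pose C_ n := n%:R^-1 *: gram n.
pose W n w := Num.sqrt n%:R *: (invmx (gram n) *m ((X n)^T *m e n w)).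
pose tau n j := Num.sqrt n%:R * beta n j ord0.
pose Un n w := Num.sqrt (n%:R / ls n) *: (bAL n w - beta n).
pose Rel n (y u : 'cV[R]_p) := is_argmin (rescaled_obj C_ ls lam tau n y) u.
have large : \forall n \near \oo, [/\ (p <= n)%N, (0 < n)%N & 0 < ls n].
  near=> n; split; near: n; [exact: nbhs_infty_ge|exact: nbhs_infty_gt|].
  exact: ((cvgryPgt _).1 lsy).
have mW : \forall n \near \oo, rand_mx (W n).
  apply: filterS large => n [pn _ _] i j.
  have [me _ _ _] := iid n pn.
  have := rand_mx_mulmx (invmx (gram n)) (rand_mx_mulmx (X n)^T me).
  move=> /(_ i j) h; rewrite /W; under eq_fun do rewrite mxE.
  exact: measurable_funM.
have mUn : \forall n \near \oo, rand_mx (Un n).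
  apply: filterS large => n [pn _ _] i j.
  rewrite /Un; under eq_fun do rewrite !mxE.
  by apply: measurable_funM => //; apply: measurable_funB => //; exact: mbAL.
have RelW : \forall n \near \oo, {ae P, forall w, Rel n (W n w) (Un n w)}.
  apply: filterS large => n [pn n0 ls0].
  have LSne : {ae P, forall w, forall j, ls_est (X n) (X n *m beta n + e n w) j ord0 != 0}.
    apply: filter_forall => j.
    exists [set w | ls_est (X n) (X n *m beta n + e n w) j ord0 = 0]; split.
    - have [me _ _ _] := iid n pn.
      have h := rand_mx_mulmx (invmx (gram n)) (rand_mx_mulmx (X n)^T me) j ord0.
      have mLS : measurable_fun setT (fun w => ls_est (X n) (X n *m beta n + e n w) j ord0).
        under eq_fun do rewrite ls_est_linear_model ?rX// mxE.
        exact: measurable_funD.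
      by have := mLS measurableT [set 0] (measurable_set1 _); rewrite setTI.
    - exact: LS0.
    - by move=> w /= /negP; rewrite negbK => /eqP.
  apply: filterS LSne => w /(bALmin n pn w).
  rewrite /Rel /Un.
  have s0' : Num.sqrt (ls n / n%:R) != 0.
    by rewrite gt_eqF// sqrtr_gt0 divr_gt0// ltr0n.
  have -> : Num.sqrt (n%:R / ls n) = (Num.sqrt (ls n / n%:R))^-1.
    by rewrite -sqrtrV ?invf_div// divr_ge0// ltW.
  apply: (@argmin_affine_rescale _ _ _ _ _ _
    (al_obj (X n) (X n *m beta n + e n w) (lam n) (beta n)) (ls n)) => // u.
  by rewrite al_obj_rescale// rX.
have C_ge0 n u : 0 <= qform (C_ n) u.
  rewrite /C_ qformZ mulr_ge0 ?invr_ge0// qform_gram.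
  by apply: sumr_ge0 => i _; exact: sqr_ge0.
have phic' j : (\forall n \near \oo, 0 < lam n j) ->
    (fun n => (tau n j * Num.sqrt (ls n) / lam n j)%:E) @ \oo --> phi j by exact: phic.
have finE (V : nat -> Omega -> 'cV[R]_p) : (\forall n \near \oo, rand_mx (V n)) ->
    \forall n \near \oo, (\int[P]_w (f (V n w))%:E)%E \is a fin_num.
  apply: filterS => n mV.
  apply: (bounded_expectation_fin_num P _ (fun w => fM (V n w))).
  exact: rand_mx_continuous.
have mfU : measurable_fun setT (fun w => f (U w)) by exact: rand_mx_continuous.
have fU := bounded_expectation_fin_num Q mfU (fun w => fM (U w)).
rewrite -(fineK fU); apply/fine_cvgP; split; first exact: finE.
(* If convergence fails for [eps], the bad indices belong to an ultrafilter [G] refining [\oo]; a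
   bad index satisfying both one-sided bounds will be a contradiction. *)
apply/cvgrPdist_le => eps eps0; apply: contrapT => nconv.
pose good : set nat := [set n | `|fine (\int[Q]_w (f (U w))%:E)
  - fine (\int[P]_w (f (Un n w))%:E)| <= eps].
have WF : ProperFilter (within (~` good) \oo).
  split; last exact: within_filter.
  by rewrite /within /= => h; apply: nconv; apply: filterS h => t /=; exact: contrapT.
have [G [GU sG]] := ultraFilterLemma WF.
have Goo D : (\forall n \near \oo, D n) -> G D.
  by move=> h; apply: sG; apply: filterS h => n.
have Gbad : G (~` good) by apply: sG; apply: (@filterS _ \oo) filterT => n.
have [c /choice[B cB]] := choice (fun j => ultra_separation (tau ^~ j) GU).
(* Each [A k] lies in [G]; it forces large indices and the separation of every coordinate of [tau]
   at once. *)
pose A k := [set m | (k <= m)%N /\ forall j, B j k m].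
have GA k : G (A k).
  apply: filterI; first by apply: Goo; exact: nbhs_infty_ge.
  by apply: filter_forall => j; have [GB _ _] := cB j; exact: GB.
have A_decr k l : (k <= l)%N -> A l `<=` A k.
  move=> kl m [lm Bm]; split; first exact: leq_trans lm.
  by move=> j; have [_ Bd _] := cB j; exact: Bd (Bm j).
(* Two null events are discarded: [Z j = c j], where [tau j + Z j] may approach 0, and, for nonzero
   [fine (psi j)], the vanishing of [phi j + psi j * Z j]. *)
have Zgood : {ae Q, forall w j, Z w j ord0 != c j /\
    Z w j ord0 != - (fine (phi j) / fine (psi j))}.
  apply: filter_forall => j; apply: filterI.
    exact: gaussian_vec_coord_null Cpd s0 gZ.
  exact: gaussian_vec_coord_null Cpd s0 gZ.
have RelZ : {ae Q, forall w, forall D, nbhs (U w) D ->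
    exists k, \forall y \near Z w, forall m u, A k m -> Rel m y u -> D u}.
  apply: filterS2 Zgood Umin => w Zw Uw.
  apply: (rescaled_argmin_near (proj2 Cpd) C_ge0 Xcvg lam_ge0 lamd lsy lamc psic phic'
    A_decr _ _ _ Uw).
  - by move=> k m [].
  - move=> j; have [_ _ /(_ (Z w j ord0) (Zw j).1)[de [k [de0 dk]]]] := cB j.
    by exists de, k; split => // m [_ Bm]; exact: dk.
  - move=> j psi0; have := (Zw j).2; apply: contra_neq => h.
    apply: (mulfI psi0); rewrite mulrN mulrCA divff// mulr1.
    by apply/eqP; rewrite eq_sym -subr_eq0 -opprD oppr_eq0 h.
(* The mapping theorem gives upper bounds only; applying it to [- f] as well supplies the lower
   one. *)
have mNf : continuous (fun x => - f x) by move=> x; apply: continuousN; exact: cf.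
have NfM x : `|- f x| <= M by rewrite normrN.
have mZ := proj1 gZ.
have [k1 up] := relational_mapping cf fM A_decr mW mUn mZ mU WZ RelW RelZ eps0.
have [k2 down] := relational_mapping mNf NfM A_decr mW mUn mZ mU WZ RelW RelZ eps0.
have expN d0 (T : measurableType d0) (mu : probability T R) (V : T -> 'cV[R]_p) :
    rand_mx V -> (\int[mu]_w (- f (V w))%:E = - \int[mu]_w (f (V w))%:E)%E.
  move=> mV; rewrite -integralN//; apply: integrable_add_def => //.
  apply: (@bounded_integrable _ _ _ mu (fun w => f (V w)) M) => [|w]; last exact: fM.
  exact: rand_mx_continuous.
have [n [ngood An1 An2 [nup ndown nfin mUnn]]] : exists n,
    [/\ (~` good) n, A k1 n, A k2 n &
     [/\ A k1 n -> (\int[P]_w (f (Un n w))%:E <= \int[Q]_w (f (U w))%:E + eps%:E)%E,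
         A k2 n -> (\int[P]_w (- f (Un n w))%:E <= \int[Q]_w (- f (U w))%:E + eps%:E)%E,
         (\int[P]_w (f (Un n w))%:E)%E \is a fin_num & rand_mx (Un n)]].
  have Gup := Goo _ up; have Gdown := Goo _ down.
  have Gfin := Goo _ (finE _ mUn); have GmUn := Goo _ mUn.
  apply: (@filter_ex _ G); near=> n; split; [by near: n| | |split].
  - by near: n; exact: GA.
  - by near: n; exact: GA.
  - by near: n.
  - by near: n.
  - by near: n.
  - by near: n.
apply: ngood; rewrite /good /=.
move: (nup An1) (ndown An2); rewrite !expN//.
rewrite -(fineK fU) -(fineK nfin) -!EFinN -!EFinD !lee_fin ler_norml => h1 h2.
by apply/andP; split; lra.
Unshelve. all: by end_near. Qed.
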